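(* Let $\mathcal{H}$ be a real Hilbert space, let $\alpha\in\,]0,+\infty[$, let $W\colon\mathcal{H}\to 2^{\mathcal{H}}$ be maximally monotone, let $C\colon\mathcal{H}\to\mathcal{H}$ be $\alpha$-cocoercive and such that $Z=\mathrm{zer}(W+C)\neq\varnothing$, let $x_0\in\mathcal{H}$, and let $(\lambda_n)_{n\in\mathbb{N}}$ be a sequence in $]0,1]$. Iterate, for every $n\in\mathbb{N}$: choose arbitrary $(w_n,w_n^* )\in\mathrm{gra}\,W$ and $q_n\in\mathcal{H}$, and set $$t_n^*=w_n^*+Cq_n,\qquad \delta_n=\langle x_n-w_n\mid t_n^*\rangle-\frac{\|w_n-q_n\|^2}{4\alpha},$$ $$d_n=\begin{cases}\dfrac{\delta_n}{\|t_n^*\|^2}t_n^*,&\text{if }\delta_n>0;\\ 0,&\text{otherwise,}\end{cases}\qquad r_n=x_n-\lambda_nd_n,\qquad x_{n+1}=\mathsf{Q}(x_0,x_n,r_n).$$ Then the following hold: (i) $(x_n)_{n\in\mathbb{N}}$ is bounded. (ii) $\sum_{n\in\mathbb{N}}\|x_{n+1}-x_n\|^2<+\infty$. (iii) $\sum_{n\in\mathbb{N}}\lambda_n^2\|d_n\|^2<+\infty$. (iv) Suppose that $w_n-x_n\rightharpoonup 0$, $w_n-q_n\to 0$, and $t_n^*\to 0$. Then $(x_n)_{n\in\mathbb{N}}$ converges strongly to $\mathrm{proj}_Zx_0$.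
   Context: For $M\colon\mathcal{H}\to2^{\mathcal{H}}$, $\mathrm{gra}\,M=\{(x,x^* )\mid x^*\in Mx\}$ and $\mathrm{zer}\,M=\{x\mid 0\in Mx\}$. $M$ is monotone if $\langle x-y\mid x^*-y^*\rangle\ge0$ for all $(x,x^* ),(y,y^* )\in\mathrm{gra}\,M$, and maximally monotone if no monotone operator has a graph strictly containing $\mathrm{gra}\,M$. $C\colon\mathcal{H}\to\mathcal{H}$ is $\alpha$-cocoercive if $\langle x-y\mid Cx-Cy\rangle\ge\alpha\|Cx-Cy\|^2$ for all $x,y$. $\rightharpoonup$ and $\to$ denote weak and strong convergence, and $\mathrm{proj}_D$ is the projection operator onto a nonempty closed convex set $D$. For $(x,y)\in\mathcal{H}^2$, $H(x,y)=\{z\in\mathcal{H}\mid\langle z-y\mid x-y\rangle\leq 0\}$; for $(x,y,z)\in\mathcal{H}^3$ such that $H(x,y)\cap H(y,z)\neq\varnothing$, $\mathsf{Q}(x,y,z)$ is the projection of $x$ onto $H(x,y)\cap H(y,z)$. *)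

(* Defs.v *)
From HB Require Import structures.
From mathcomp Require Import all_boot all_order all_algebra.
From mathcomp Require Import all_classical all_reals all_analysis.
Import Order.TTheory GRing.Theory Num.Theory.
Import numFieldNormedType.Exports.

Set Implicit Arguments.
Unset Strict Implicit.
Unset Printing Implicit Defensive.

Local Open Scope classical_set_scope.
Local Open Scope ring_scope.

(* A real Hilbert space is a complete normed space whose norm is induced by a
   symmetric positive definite bilinear form. *)
HB.mixin Record CompleteNormedModule_isHilbert (R : realType) H
    of CompleteNormedModule R H := {
  inner : {dot H for (@idfun R)} ;
  inner_norm : forall x : H, inner x x = `|x| ^+ 2
}.

#[short(type="hilbertType")]
HB.structure Definition Hilbert (R : realType) :=
  {H of CompleteNormedModule R H & CompleteNormedModule_isHilbert R H}.

Section Operators.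
Context {R : realType} {H : hilbertType R}.
Implicit Types (M W : H -> set H) (C : H -> H) (D : set H) (x y z : H).

Definition gra M : set (H * H) := [set p | M p.1 p.2].

Definition zer M : set H := [set x | M x 0].

Definition monotone_op M : Prop := forall p q, gra M p -> gra M q ->
  0 <= inner (p.1 - q.1) (p.2 - q.2).

Definition maximally_monotone M : Prop := monotone_op M /\
  ~ exists N : H -> set H, monotone_op N /\ gra M `<` gra N.

Definition cocoercive (a : R) C : Prop := forall x y,
  a * `|C x - C y| ^+ 2 <= inner (x - y) (C x - C y).

Definition addop W C : H -> set H := fun x => [set w + C x | w in W x].

(* The nearest point of D to x, which exists and is unique when D is nonempty,
   closed and convex; the junk value x is returned if there is none. *)
Definition metric_proj D x : H :=
  xget x [set p | D p /\ forall y, D y -> `|x - p| <= `|x - y|].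

Definition halfspace x y : set H := [set z | inner (z - y) (x - y) <= 0].

Definition Q x y z : H := metric_proj (halfspace x y `&` halfspace y z) x.

Definition weak_cvg (u : nat -> H) x : Prop :=
  forall y, inner (u n) y @[n --> \oo] --> inner x y.

End Operators.

(* Main.v *)
(* Cocoercivity of C gives <z - w_n | t_n^*> <= ||w_n - q_n||^2 / (4 alpha) for
   every zero z, so Z lies in H(x_n, r_n), and by induction also in H(x_0, x_n).
   Hence ||x_n - x_0|| is nondecreasing and bounded by the distance from x_0 to
   Z; telescoping yields the summability claims.

   For strong convergence, no sum theorem for maximally monotone operators is
   needed.  Along an ultrafilter, let z be the weak limit of x_n (hence of w_n
   and q_n) and c that of C q_n.  Adding the monotonicity inequalities of W at
   (y, v) and of C at y', the terms that are not weakly continuous combine into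
   <w_n | t_n^*> - <w_n - q_n | C q_n>, which tends to 0, and the limit is
     0 <= <z - y | - c - v> + <z - y' | c - C y'>.
   Taking y' = z gives - c in W z by maximality; then (y, v) = (z, - c) gives
   c = C z, so z is a zero.  Finally the inclusion of Z in H(x_0, x_n) makes the
   convergence strong and identifies z as the projection of x_0. *)
Require Import Defs.
From mathcomp Require Import all_boot all_order all_algebra.
From mathcomp Require Import all_classical all_reals all_analysis.
From mathcomp Require Import ring lra.
Import Order.TTheory GRing.Theory Num.Theory.
Import numFieldNormedType.Exports.

Local Open Scope classical_set_scope.
Local Open Scope ring_scope.

(** * Inner product calculus, Cauchy-Schwarz and limits of inner products *)

Section InnerProduct.
Context {R : realType} {H : hilbertType R}.
Implicit Types (x y z u v : H) (a b t : R) (D : set H).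

Lemma innerC x y : inner x y = inner y x.
Proof. by rewrite hermC /= mul1r. Qed.

Lemma innerDl x y z : inner (x + y) z = inner x z + inner y z.
Proof. exact: linearDl. Qed.

Lemma innerDr x y z : inner z (x + y) = inner z x + inner z y.
Proof. exact: linearDr. Qed.

Lemma innerZl a x y : inner (a *: x) y = a * inner x y.
Proof. exact: linearZl. Qed.

Lemma innerZr a x y : inner x (a *: y) = a * inner x y.
Proof. by rewrite innerC innerZl innerC. Qed.

Lemma innerNl x y : inner (- x) y = - inner x y.
Proof. by rewrite -scaleN1r innerZl mulN1r. Qed.

Lemma innerNr x y : inner x (- y) = - inner x y.
Proof. by rewrite innerC innerNl innerC. Qed.

Lemma inner0l x : inner 0 x = 0.
Proof. by rewrite -(scale0r 0) innerZl mul0r. Qed.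

Lemma inner0r x : inner x 0 = 0.
Proof. by rewrite innerC inner0l. Qed.

Definition innerE :=
  (innerDl, innerDr, innerNl, innerNr, innerZl, innerZr, inner0l, inner0r).

Lemma inner_ge0 x : 0 <= inner x x.
Proof. by rewrite inner_norm sqr_ge0. Qed.

Lemma inner_eq0 x : inner x x = 0 -> x = 0.
Proof. by rewrite inner_norm => /eqP; rewrite sqrf_eq0 normr_eq0 => /eqP. Qed.

Lemma cauchy_schwarz x y : `|inner x y| <= `|x| * `|y|.
Proof.
have [->|y0] := eqVneq y 0; first by rewrite inner0r !normr0 mulr0.
have y2 : 0 < inner y y by rewrite inner_norm exprn_gt0 ?normr_gt0.
rewrite -(@ler_pXn2r _ 2) ?nnegrE ?mulr_ge0 // exprMn -!inner_norm.
rewrite real_normK ?num_real //.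
(* This is [inner y y] times the component of [x] orthogonal to [y]; the scaling avoids a
   division. *)
have := inner_ge0 (inner y y *: x - inner x y *: y).
rewrite !innerE (innerC y x) => h.
have {h} : 0 <= inner y y * (inner x x * inner y y - inner x y ^+ 2) by lra.
by rewrite pmulr_rge0 // subr_ge0.
Qed.

Lemma inner_le_norm x y : inner x y <= `|x| * `|y|.
Proof. exact: le_trans (ler_norm _) (cauchy_schwarz x y). Qed.

Lemma cvg_inner {T : Type} {F : set_system T} {FF : Filter F} (u : T -> H) x y :
  u n @[n --> F] --> x -> inner (u n) y @[n --> F] --> inner x y.
Proof.
move=> ux; apply/cvgrPdist_lt => e e0.
have d0 : 0 < e / (`|y| + 1) by rewrite divr_gt0 // ltr_wpDl.
move/cvgrPdist_lt : ux => /(_ _ d0); apply: filterS => n un.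
rewrite -innerNl -innerDl; apply: le_lt_trans (cauchy_schwarz _ _) _.
move: un; rewrite ltr_pdivlMr ?ltr_wpDl // => un.
by apply: le_lt_trans un; rewrite ler_wpM2l // lerDl.
Qed.

Lemma cvg_inner0_bounded {T : Type} {F : set_system T} {FF : Filter F}
    (u v : T -> H) M :
  (forall n, `|u n| <= M) -> v n @[n --> F] --> 0 ->
  inner (u n) (v n) @[n --> F] --> 0.
Proof.
move=> uM v0; apply/cvgrPdist_lt => e e0.
have M0 : 0 < `|M| + 1 by rewrite ltr_wpDl.
have d0 : 0 < e / (`|M| + 1) by rewrite divr_gt0.
move/cvgrPdist_lt : v0 => /(_ _ d0); apply: filterS => n.
rewrite !sub0r !normrN ltr_pdivlMr // => vn.
apply: le_lt_trans (cauchy_schwarz _ _) _; apply: le_lt_trans vn.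
rewrite mulrC ler_wpM2l //; apply: le_trans (uM n) _.
by rewrite (le_trans (ler_norm M)) // lerDl.
Qed.

(** * Projections onto closed convex sets *)

Lemma closed_halfspace x y : closed (halfspace x y).
Proof.
have -> : halfspace x y =
    (fun z => inner (z - y) (x - y)) @^-1` [set a | a <= 0] by [].
apply: preimage_closed; last exact: closed_le.
move=> z _; apply: cvg_inner; apply: cvgB; [exact: cvg_id|exact: cvg_cst].
Qed.

(** Convexity, written so that a point of the segment is a perturbation of its endpoint [y]. *)
Definition segment_closed D := forall y z t,
  D y -> D z -> 0 <= t <= 1 -> D (y + t *: (z - y)).

Lemma segment_closed_halfspace x y : segment_closed (halfspace x y).
Proof.
move=> u v t; rewrite /halfspace /= !innerE => hu hv /andP[t0 t1]; nra.
Qed.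

Lemma segment_closedI D1 D2 :
  segment_closed D1 -> segment_closed D2 -> segment_closed (D1 `&` D2).
Proof. by move=> h1 h2 y z t [? ?] [? ?] ?; split; [apply: h1|apply: h2]. Qed.

(** A minimizing sequence is Cauchy by the parallelogram identity, so completeness yields a limit,
    which attains the infimum. *)
Lemma nearest_point D x : D !=set0 -> closed D -> segment_closed D ->
  exists2 p, D p & forall y, D y -> `|x - p| <= `|x - y|.
Proof.
move=> D0 Dcl Dcv.
pose S := [set inner (x - y) (x - y) | y in D]; pose m := inf S.
have S0 : S !=set0 by case: D0 => y Dy; exists (inner (x - y) (x - y)), y.
have Slb : has_lbound S by exists 0 => _ [y _ <-]; exact: inner_ge0.
have mle y : D y -> m <= inner (x - y) (x - y).
  by move=> Dy; apply: ge_inf => //; exists y.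
have ex n : exists y, D y /\ inner (x - y) (x - y) < m + n.+1%:R^-1.
  have [_ [y Dy <-] h] := @inf_adherent _ S n.+1%:R^-1 ltac:(by []) (conj S0 Slb).
  by exists y.
have /choice[y yP] := ex.
have yD n : D (y n) by have [] := yP n.
have half01 : 0 <= (2^-1 : R) <= 1 by rewrite invr_ge0 ler0n invf_le1 ?ler1n.
(* The midpoint of [y i] and [y j] lies in [D], so its squared distance to [x] is at least [m]; the
   parallelogram identity then cancels the terms in [m]. *)
have dist i j : inner (y i - y j) (y i - y j) <= 2 * i.+1%:R^-1 + 2 * j.+1%:R^-1.
  have := mle _ (Dcv _ _ _ (yD i) (yD j) half01).
  have [_] := yP i; have [_] := yP j; rewrite !innerE.
  rewrite (innerC (y i) x) (innerC (y j) x) (innerC (y j) (y i)).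
  by move: (i.+1%:R^-1) (j.+1%:R^-1) => a b h1 h2 h3; lra.
have ycvg : cvgn y.
  apply/cauchy_cvgP/cauchy_exP => e e0.
  have e4 : 0 < e ^+ 2 / 4 by rewrite divr_gt0 ?exprn_gt0.
  have /cvgrPdist_lt /(_ _ e4) [N _ hN] := @cvg_harmonic R.
  exists (y N); exists N => // n /= Nn; rewrite -ball_normE /=.
  rewrite -(@ltr_pXn2r _ 2) ?nnegrE ?(ltW e0) // -inner_norm.
  apply: le_lt_trans (dist N n) _.
  have := hN n Nn; have := hN N (leqnn N); rewrite /harmonic /= !sub0r !normrN.
  rewrite !ger0_norm ?invr_ge0 //.
  by move: (N.+1%:R^-1) (n.+1%:R^-1) => a b h1 h2; lra.
exists (limn y); first by apply: (closed_cvg _ Dcl _ _ ycvg); exact: nearW.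
move=> z Dz.
rewrite -(@ler_pXn2r _ 2) ?nnegrE // -!inner_norm; apply: le_trans (mle z Dz).
rewrite inner_norm expr2 -[m]addr0.
apply: (@ler_cvg_to _ \oo _ _ (fun n => `|x - y n| * `|x - y n|)
                              (fun n => m + harmonic n)).
- by apply: cvgM; apply: cvg_norm; apply: cvgB;
    [exact: cvg_cst|exact: ycvg|exact: cvg_cst|exact: ycvg].
- apply: cvgD; [exact: cvg_cst|exact: cvg_harmonic].
- by apply: nearW => n; rewrite -expr2 -inner_norm ltW //; have [] := yP n.
Qed.

Lemma nearest_variational D x p : segment_closed D -> D p ->
  (forall y, D y -> `|x - p| <= `|x - y|) ->
  forall y, D y -> inner (y - p) (x - p) <= 0.
Proof.
move=> Dcv Dp pmin y Dy; rewrite leNgt; apply/negP.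
set c := inner _ _ => c0; pose b := inner (y - p) (y - p).
have b0 : 0 <= b by exact: inner_ge0.
have bc0 : 0 < b + c by rewrite ltr_wpDl.
(* Minimality at [p + t *: (y - p)] forces [2 * c <= t * b], whereas this choice gives
   [t * b < c]. *)
pose t := c / (b + c).
have tbc : t * (b + c) = c by rewrite /t divfK ?gt_eqF.
have t0 : 0 < t by rewrite divr_gt0.
have t1 : t <= 1 by rewrite ler_pdivrMr // mul1r lerDr.
have := pmin _ (Dcv _ _ t Dp Dy ltac:(by rewrite (ltW t0) t1)).
rewrite -(@ler_pXn2r _ 2) ?nnegrE // -!inner_norm opprD addrA.
rewrite [inner (x - p - _) _]innerDl !innerNl !innerZl.
rewrite [inner _ (x - p - _)]innerDr [inner (y - p) (x - p - _)]innerDr.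
rewrite !innerNr !innerZr (innerC (x - p)) -/c -/b => h.
have : t * (2 * c) <= t * (t * b) by lra.
rewrite ler_pM2l // => h2; nra.
Qed.

(** Expanding the squared distance around [p] shows that [p] is a minimizer and that any other
    minimizer is at distance 0 from it, so [xget] can only return [p]. *)
Lemma metric_proj_unique D x p : D p ->
  (forall y, D y -> inner (y - p) (x - p) <= 0) -> metric_proj D x = p.
Proof.
move=> Dp pvar.
have expand y : inner (x - y) (x - y) = inner (x - p) (x - p) +
    inner (y - p) (y - p) - 2 * inner (y - p) (x - p).
  rewrite !innerE (innerC y p) (innerC x p) (innerC x y); lra.
apply: xget_unique; first split=> // y Dy.
  rewrite -(@ler_pXn2r _ 2) ?nnegrE // -!inner_norm (expand y).
  have := pvar y Dy; have := inner_ge0 (y - p); lra.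
move=> y [Dy /(_ p Dp)]; rewrite -(@ler_pXn2r _ 2) ?nnegrE // -!inner_norm.
rewrite (expand y) => h; apply/eqP; rewrite -subr_eq0; apply/eqP/inner_eq0.
have := pvar y Dy; have := inner_ge0 (y - p); lra.
Qed.

Lemma metric_projP D x : D !=set0 -> closed D -> segment_closed D ->
  D (metric_proj D x) /\
  forall y, D y -> inner (y - metric_proj D x) (x - metric_proj D x) <= 0.
Proof.
move=> D0 Dcl Dcv; have [p Dp pmin] := nearest_point D x D0 Dcl Dcv.
have pvar := nearest_variational D x p Dcv Dp pmin.
by rewrite (metric_proj_unique D x p Dp pvar).
Qed.

(** * Riesz representation and weak compactness along ultrafilters *)

Lemma riesz (phi : H -> R) M : (forall x y, phi (x + y) = phi x + phi y) ->
  (forall a x, phi (a *: x) = a * phi x) -> (forall x, `|phi x| <= M * `|x|) ->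
  exists z, forall y, phi y = inner z y.
Proof.
move=> phiD phiZ phiM.
have phiB x y : phi (x - y) = phi x - phi y.
  by rewrite phiD -scaleN1r phiZ mulN1r.
have [[e phie]|phi0] := pselect (exists e, phi e != 0); last first.
  exists 0 => y; rewrite inner0l; apply/eqP/negPn/negP => phiy.
  by apply: phi0; exists y.
pose D := [set y | phi y = 1].
have phic : continuous phi.
  move=> u; apply/cvgrPdist_lt => a a0; near=> v.
  rewrite -phiB; apply: le_lt_trans (phiM _) _.
  have M0 : 0 < `|M| + 1 by rewrite ltr_wpDl.
  apply: (@le_lt_trans _ _ ((`|M| + 1) * `|u - v|)).
    by rewrite ler_wpM2r // (le_trans (ler_norm M)) // lerDl.
  rewrite mulrC -ltr_pdivlMr //; near: v.
  by apply: cvgr_dist_lt; rewrite ?divr_gt0 //; exact: cvg_id.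
have Dcl : closed D.
  have -> : D = phi @^-1` [set 1] by [].
  by apply: preimage_closed; [move=> u _; exact: phic|exact: closed_eq].
have Dcv : segment_closed D.
  move=> y z t /= Dy Dz _.
  by rewrite /D /= phiD phiZ phiB Dy Dz subrr mulr0 addr0.
have D0 : D !=set0 by exists ((phi e)^-1 *: e); rewrite /D /= phiZ mulVf.
(* The representer is a multiple of the projection of 0 onto the hyperplane [phi y = 1]. *)
have [] := metric_projP D 0 D0 Dcl Dcv; set p := metric_proj D 0 => Dp pvar.
(* Both [p + k] and [p - k] lie in the hyperplane, and their variational inequalities have opposite
   signs. *)
have ker k : phi k = 0 -> inner p k = 0.
  move=> k0.
  have hp : D (p + k) by rewrite /D /= phiD k0 addr0.
  have hm : D (p - k) by rewrite /D /= phiB k0 subr0.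
  have := pvar _ hp; have := pvar _ hm.
  rewrite !innerE !(innerC k p) => h1 h2; lra.
have pp : inner p p != 0.
  apply/eqP => /inner_eq0 p0; move: Dp; rewrite p0 /D /= -(scale0r 0) phiZ mul0r.
  by move/eqP; rewrite eq_sym oner_eq0.
exists ((inner p p)^-1 *: p) => y.
have : inner p (y - phi y *: p) = 0.
  by apply: ker; rewrite phiB phiZ Dp mulr1 subrr.
rewrite !innerE => /eqP; rewrite subr_eq0 => /eqP ->.
by rewrite mulrCA mulVf // mulr1.
Unshelve. all: by end_near. Qed.

Lemma ultrafilter_cvg_bounded {T : Type} {U : set_system T} {FU : UltraFilter U}
  (f : T -> R) M : (forall n, `|f n| <= M) -> cvg (f n @[n --> U]).
Proof.
move=> fM; have PF := @ultra_proper _ _ FU.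
have cpt : compact `[- M, M] by exact: segment_compact.
have fU : (f @ U) `[- M, M]%classic.
  by apply: nearW => n; rewrite /= in_itv /= -ler_norml.
have [c [_ cc]] := cpt (f @ U) _ fU.
apply/cvg_ex; exists c => V cV.
have [//|UV] := in_ultra_setVsetC (f @^-1` V) FU.
have [a [Va nVa]] := cc (~` V) V UV cV.
by [].
Qed.

(** Takes the place of extracting a weakly convergent subsequence: the limits of [inner (u n) y]
    along [U] form a bounded linear functional of [y], represented by Riesz. *)
Lemma ultrafilter_weak_cvg {U : set_system nat} {FU : UltraFilter U}
    (u : nat -> H) M : (forall n, `|u n| <= M) ->
  exists z, forall y, inner (u n) y @[n --> U] --> inner z y.
Proof.
move=> uM; have PF := @ultra_proper _ _ FU.
have ub y n : `|inner (u n) y| <= M * `|y|.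
  by apply: le_trans (cauchy_schwarz _ _) _; rewrite ler_wpM2r.
have uc y : cvg (inner (u n) y @[n --> U]).
  exact: ultrafilter_cvg_bounded (ub y).
pose phi y := lim (inner (u n) y @[n --> U]).
have phiP y : inner (u n) y @[n --> U] --> phi y by exact: uc.
have phiE y l : inner (u n) y @[n --> U] --> l -> phi y = l.
  by apply: cvg_lim; exact: Rhausdorff.
have [||y|z zP] := @riesz phi M.
- move=> x y; apply: phiE.
  rewrite (_ : (fun n => inner (u n) (x + y)) =
               (fun n => inner (u n) x + inner (u n) y)).
    by apply: cvgD; exact: phiP.
  by apply/funext => n; rewrite innerDr.
- move=> a x; apply: phiE.
  rewrite (_ : (fun n => inner (u n) (a *: x)) = (fun n => a * inner (u n) x)).
    by apply: cvgM; [exact: cvg_cst|exact: phiP].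
  by apply/funext => n; rewrite innerZr.
- apply: (@ler_cvg_to _ U _ _ (fun n => `|inner (u n) y|) (fun=> M * `|y|)).
  + exact: cvg_norm.
  + exact: cvg_cst.
  + exact: nearW.
- by exists z => y; rewrite -zP.
Qed.

End InnerProduct.

(** * Monotone and cocoercive operators, and zeros of their sum *)

Section MonotoneOperators.
Context {R : realType} {H : hilbertType R}.
Implicit Types (W : H -> set H) (C : H -> H) (x y z c : H) (a : R).

(** Uniform boundedness principle for the functionals [inner (u n)], which are pointwise bounded
    because they converge pointwise. *)
Lemma weak_cvg_bounded (u : nat -> H) z :
  weak_cvg u z -> exists M, forall n, `|u n| <= M.
Proof.
move=> uz; pose f n y : R^o := inner (u n) y.
have [f_|y|M fM] := @Banach_Steinhauss R H R^o (range f) _ _ 1.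
- move=> [n _ <-]; split; last by move=> a x y; rewrite /f !innerE.
  move=> r; exists (`|u n| * r) => y yr.
  by apply: le_trans (cauchy_schwarz _ _) _; rewrite ler_wpM2l.
- have [M [_ /(_ (M + 1)) hM]] : bounded_fun (fun n => inner (u n) y).
    by apply: cvg_seq_bounded; apply/cvg_ex; exists (inner z y); exact: uz.
  exists (M + 1) => _ [n _ <-]; apply: hM => //; by rewrite ltrDl.
exists M => n; have [->|un0] := eqVneq (u n) 0.
  rewrite normr0; have f0 : range f (f 0%N) by exists 0%N.
  by apply: le_trans (fM _ f0 0 _); rewrite ?normr0.
have fn : range f (f n) by exists n.
(* The bound on the unit ball, tested at the normalized vector, recovers the norm of [u n]. *)
have := fM _ fn (`|u n|^-1 *: u n).
rewrite /f innerZr inner_norm expr2 mulKf ?normr_eq0 // normr_id; apply.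
by rewrite normrZ normfV normr_id mulVf ?normr_eq0.
Qed.

(** Otherwise adjoining [(z, c)] to the graph would give a strictly larger monotone graph. *)
Lemma maximally_monotone_mem W z c : maximally_monotone W ->
  (forall y v, W y v -> 0 <= inner (z - y) (c - v)) -> W z c.
Proof.
move=> [mono maxi] h; apply: contrapT => nWzc; apply: maxi.
exists (fun y => W y `|` [set v | y = z /\ v = c]); split; last first.
  split; first by move=> p; left.
  by move=> /(_ (z, c)) /= sub; apply: nWzc; apply: sub; right.
move=> [p1 p2] [q1 q2] [pW|[/= -> ->]] [qW|[/= -> ->]].
- exact: (mono (p1, p2) (q1, q2)).
- by rewrite -(opprB z) -(opprB c) innerNl innerNr opprK; exact: h.
- exact: h.
- by rewrite subrr inner0l.
Qed.

Lemma cocoercive_bound a C x y : 0 < a -> cocoercive a C ->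
  `|C x - C y| <= a^-1 * `|x - y|.
Proof.
move=> a0 hC; have [->|n0] := eqVneq (C x - C y) 0.
  by rewrite normr0 mulr_ge0 ?invr_ge0 // ltW.
rewrite -(ler_pM2l a0) mulVKf ?gt_eqF //.
rewrite -(@ler_pM2r _ `|C x - C y|) ?normr_gt0 // -mulrA -expr2.
exact: le_trans (hC x y) (inner_le_norm _ _).
Qed.

(* Minty's trick: test the hypothesis at [z + (a / 2) (c - C z)]. *)
Lemma cocoercive_mem a C z c : 0 < a -> cocoercive a C ->
  (forall y, 0 <= inner (z - y) (c - C y)) -> c = C z.
Proof.
move=> a0 hC h; apply/eqP; rewrite -subr_eq0; apply/eqP/inner_eq0.
pose e := c - C z; pose y := z + (a / 2) *: e; pose g := C y - C z.
have h1 := hC y z; have h2 := h y.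
rewrite -inner_norm -/g /y addrAC subrr add0r innerZl in h1.
have eg : c - C y = e - g by rewrite /e /g opprB addrA subrK.
rewrite eg opprD addrA subrr add0r innerNl innerZl oppr_ge0 innerDr innerNr in h2.
rewrite -/e; clear eg; clearbody g; clear y; clearbody e.
(* Together, [h1], [h2] and [h3] give [inner e e >= 2 * inner e g >= 2 * inner e e], whence
   [e = 0]. *)
have h3 := inner_ge0 (e - 2 *: g).
rewrite !innerE (innerC g e) in h3.
have {}h1 : 2 * inner g g <= inner e g.
  rewrite -(ler_pM2l a0); lra.
have {}h2 : inner e e <= inner e g.
  by move: h2; rewrite pmulr_rle0 ?divr_gt0 // subr_le0.
by apply/eqP; rewrite eq_le inner_ge0 andbT; lra.
Qed.

Lemma zer_addop_weak_limit {F : set_system nat} {FF : ProperFilter F} a W C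
    (w ws q t : nat -> H) z c M :
  0 < a -> maximally_monotone W -> cocoercive a C ->
  (forall n, W (w n) (ws n)) -> (forall n, t n = ws n + C (q n)) ->
  (forall n, `|w n| <= M) -> (forall n, `|C (q n)| <= M) ->
  (forall y, inner (w n) y @[n --> F] --> inner z y) ->
  (forall y, inner (C (q n)) y @[n --> F] --> inner c y) ->
  w n - q n @[n --> F] --> 0 -> t n @[n --> F] --> 0 ->
  zer (addop W C) z.
Proof.
move=> a0 maxW hC hw ht wM CM wz Cc wq0 t0.
have key y v y' : W y v -> 0 <= inner (z - y) (- c - v) + inner (z - y') (c - C y').
  move=> Wyv.
  have wt : inner (w n) (t n) @[n --> F] --> 0.
    exact: cvg_inner0_bounded wM t0.
  have eC : inner (C (q n)) (w n - q n) @[n --> F] --> 0.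
    exact: cvg_inner0_bounded CM wq0.
  have ty : inner (t n) y @[n --> F] --> 0 by rewrite -(inner0l y); exact: cvg_inner.
  have ey : inner (w n - q n) (C y') @[n --> F] --> 0.
    by rewrite -(inner0l (C y')); exact: cvg_inner.
  (* This is the sum of the two monotonicity terms, regrouped so that every summand has a limit;
     [q n] occurs only through [w n - q n] and [C (q n)]. *)
  have lim_l : inner (w n) (t n) - inner (C (q n)) (w n - q n)
      - (inner (w n) v + inner (w n) (C y') - inner (w n - q n) (C y'))
      - inner (t n) y + (inner (C (q n)) y - inner (C (q n)) y'
        + (inner y v + inner y' (C y'))) @[n --> F] -->
      0 - 0 - (inner z v + inner z (C y') - 0) - 0
      + (inner c y - inner c y' + (inner y v + inner y' (C y'))).
    apply: cvgD; last by apply: cvgD; [apply: cvgB|exact: cvg_cst].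
    apply: cvgB => //; apply: cvgB; first exact: cvgB.
    by apply: cvgB => //; exact: cvgD.
  set l := (X in _ --> X) in lim_l.
  have -> : inner (z - y) (- c - v) + inner (z - y') (c - C y') = l.
    rewrite /l !innerE (innerC y c) (innerC y' c) (innerC z c); ring.
  apply: (closed_cvg (fun b : R => 0 <= b) (@closed_ge _ 0) _ _ lim_l).
  apply: nearW => n /=.
  have wsE : ws n = t n - C (q n) by rewrite ht addrK.
  have h1 := maxW.1 (w n, ws n) (y, v) (hw n) Wyv.
  have h2 := le_trans (mulr_ge0 (ltW a0) (sqr_ge0 _)) (hC (q n) y').
  apply: le_trans (addr_ge0 h1 h2) _; rewrite /= wsE !innerE.
  rewrite (innerC y (t n)) (innerC y (C (q n))) (innerC y' (C (q n))).
  rewrite (innerC (w n) (C (q n))) (innerC (q n) (C (q n))); lra.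
have Wzc : W z (- c).
  apply: maximally_monotone_mem maxW _ => y v Wyv.
  by have := key y v z Wyv; rewrite subrr inner0l addr0.
have cE : c = C z.
  apply: (cocoercive_mem a C) => // y.
  by have := key z (- c) y Wzc; rewrite subrr inner0l add0r.
by exists (- c) => //; rewrite cE addNr.
Qed.

Lemma zer_addop_inner_le a W C (w ws q t z : H) : 0 < a -> monotone_op W ->
  cocoercive a C -> W w ws -> t = ws + C q -> zer (addop W C) z ->
  inner (z - w) t <= `|w - q| ^+ 2 / (4 * a).
Proof.
move=> a0 mono hC hw ht [v Wzv vC].
have vE : v = - C z by apply/eqP; rewrite -addr_eq0; apply/eqP.
have h1 := mono (w, ws) (z, v) hw Wzv; have h2 := hC q z.
rewrite -!inner_norm /= in h1 h2 *.
have wsE : ws = t - C q by rewrite ht addrK.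
(* Completing the square: the factor [2 * a] makes the quadratic term in [C q - C z] exactly the one
   that cocoercivity absorbs, leaving the constant [4 * a]. *)
have h3 := inner_ge0 (w - q + (2 * a) *: (C q - C z)).
rewrite ler_pdivlMr ?mulr_gt0 //.
rewrite wsE vE opprK -addrA [- C q + _]addrC -[C z - C q]opprB in h1.
move: (C q - C z) h1 h2 h3 => g.
have -> : w - z = (w - q) + (q - z) by rewrite addrA subrK.
have -> : z - w = - (w - q) - (q - z) by rewrite -opprD addrA subrK opprB.
move: (w - q) (q - z) => e f; rewrite !innerE (innerC g e) => h1 h2 h3.
nra.
Qed.

Lemma nneseries_bounded (f : nat -> R) B : (forall n, 0 <= f n) ->
  (forall n, \sum_(0 <= k < n) f k <= B) ->
  (\sum_(0 <= n <oo) (f n)%:E < +oo)%E.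
Proof.
move=> f0 fB; apply: (@le_lt_trans _ _ B%:E); last exact: ltry.
apply: lime_le; first by apply: is_cvg_nneseries => n _ _; rewrite lee_fin.
by apply: nearW => n; rewrite sumEFin lee_fin.
Qed.

End MonotoneOperators.

(** * Haugazeau's outer approximation scheme and its convergence *)

Lemma cvg_ultrafilter {T : Type} {V : topologicalType} {F : set_system T}
    {FF : Filter F} (f : T -> V) (l : V) :
  (forall U, UltraFilter U -> F `<=` U -> f n @[n --> U] --> l) ->
  f n @[n --> F] --> l.
Proof.
move=> h A Al; apply: contrapT => nFA.
(* If [F] misses the preimage of [A], it can be refined to an ultrafilter containing the complement,
   along which [f] cannot converge to [l]. *)
have PF : ProperFilter (within (~` (f @^-1` A)) F).
  apply: Build_ProperFilter_ex => P; rewrite /within /= => PF.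
  apply: contrapT => /forallNP P0; apply: nFA; apply: filterS PF => t Pt.
  by apply: contrapT => nA; exact: (P0 t (Pt nA)).
have [U [UU FU]] := ultraFilterLemma PF.
have PU := @ultra_proper _ _ UU.
have UA : U (f @^-1` A).
  apply: (h U UU) Al => B FB; apply: FU.
  by apply: filterS FB => t Bt _.
have UnA : U (~` (f @^-1` A)) by apply: FU; rewrite /within /=; apply: filterE.
by have [t [? ?]] := filter_ex (filterI UA UnA).
Qed.

Section HaugazeauIteration.
Context {R : realType} {H : hilbertType R} (Z : set H) (x0 : H) (x r : nat -> H).
Context (Z0 : Z !=set0) (x_0 : x 0%N = x0)
  (xS : forall n, x n.+1 = Q x0 (x n) (r n))
  (Zr : forall n, Z `<=` halfspace (x n) (r n)).

(** [Z] lies in the intersection, so [Q] is a true projection and not its default value. The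
    inclusion is a premise so that the induction in [haugazeau_sub] can supply it. *)
Lemma haugazeau_proj n : Z `<=` halfspace x0 (x n) ->
  (halfspace x0 (x n) `&` halfspace (x n) (r n)) (x n.+1) /\
  (forall y, (halfspace x0 (x n) `&` halfspace (x n) (r n)) y ->
    inner (y - x n.+1) (x0 - x n.+1) <= 0).
Proof.
move=> Zx; rewrite xS; apply: metric_projP.
- by have [z Zz] := Z0; exists z; split; [exact: Zx|exact: Zr].
- by apply: closedI; exact: closed_halfspace.
- by apply: segment_closedI; exact: segment_closed_halfspace.
Qed.

(** The variational inequality of the projection at [x n.+1] is itself membership in
    [halfspace x0 (x n.+1)]. *)
Lemma haugazeau_sub n : Z `<=` halfspace x0 (x n).
Proof.
elim: n => [|n Zx] z Zz; first by rewrite /halfspace /= x_0 subrr inner0r.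
by apply: (haugazeau_proj n Zx).2; split; [exact: Zx|exact: Zr].
Qed.

Lemma haugazeau_mem n : (halfspace x0 (x n) `&` halfspace (x n) (r n)) (x n.+1).
Proof. exact: (haugazeau_proj n (haugazeau_sub n)).1. Qed.

Lemma haugazeau_dist_le n z : Z z -> `|x n - x0| <= `|z - x0|.
Proof.
move=> Zz; have := haugazeau_sub n z Zz; rewrite /halfspace /= => h.
rewrite -(@ler_pXn2r _ 2) ?nnegrE // -!inner_norm.
have := inner_ge0 (z - x n); move: h.
have -> : z - x0 = (z - x n) + (x n - x0) by rewrite addrA subrK.
rewrite -[x0 - x n]opprB; move: (z - x n) (x n - x0) => u v.
rewrite !innerE (innerC v u); lra.
Qed.

Lemma haugazeau_bounded : exists M, forall n, `|x n| <= M.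
Proof.
have [z Zz] := Z0; exists (`|z - x0| + `|x0|) => n.
rewrite -[x n](subrK x0); apply: le_trans (ler_normD _ _) _.
by rewrite lerD2r haugazeau_dist_le.
Qed.

Lemma haugazeau_step n :
  `|x n - x0| ^+ 2 + `|x n.+1 - x n| ^+ 2 <= `|x n.+1 - x0| ^+ 2.
Proof.
have [+ _] := haugazeau_mem n; rewrite /halfspace /= -!inner_norm.
have -> : x n.+1 - x0 = (x n.+1 - x n) + (x n - x0) by rewrite addrA subrK.
rewrite -[x0 - x n]opprB; move: (x n.+1 - x n) (x n - x0) => u v.
rewrite !innerE (innerC v u); lra.
Qed.

(** The angle at [r n] between [x n] and [x n.+1] is not acute, since [x n.+1] lies in
    [halfspace (x n) (r n)]. *)
Lemma haugazeau_step_ge n : `|x n - r n| ^+ 2 <= `|x n.+1 - x n| ^+ 2.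
Proof.
have [_] := haugazeau_mem n; rewrite /halfspace /= -!inner_norm.
have := inner_ge0 (x n.+1 - r n).
have -> : x n.+1 - x n = (x n.+1 - r n) - (x n - r n) by rewrite opprB addrA subrK.
move: (x n.+1 - r n) (x n - r n) => u v.
rewrite !innerE (innerC v u); lra.
Qed.

Lemma haugazeau_sum_le : exists B, forall n,
  \sum_(0 <= k < n) `|x k.+1 - x k| ^+ 2 <= B.
Proof.
have [z Zz] := Z0; exists (`|z - x0| ^+ 2) => n.
(* The partial sums telescope against the squared distance to [x0], which starts at 0. *)
apply: (@le_trans _ _ (`|x n - x0| ^+ 2)); last first.
  by rewrite ler_pXn2r ?nnegrE // haugazeau_dist_le.
elim: n => [|n IH]; first by rewrite big_nil sqr_ge0.
rewrite big_nat_recr //=; apply: le_trans (haugazeau_step n).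
by rewrite lerD2r.
Qed.

Lemma haugazeau_cvg :
  (forall U, UltraFilter U -> \oo `<=` U -> exists2 z, Z z &
    forall y, inner (x n) y @[n --> U] --> inner z y) ->
  x n @[n --> \oo] --> metric_proj Z x0.
Proof.
move=> hU; apply: cvg_ultrafilter => U UU ooU.
have PU := @ultra_proper _ _ UU.
have [z Zz xz] := hU U UU ooU.
have xz0 y : inner (x n - z) y @[n --> U] --> 0.
  rewrite -(subrr (inner z y)).
  rewrite (_ : (fun n => _) = (fun n => inner (x n) y - inner z y)).
    by apply: cvgB; [exact: xz|exact: cvg_cst].
  by apply/funext => n; rewrite !innerE.
have -> : metric_proj Z x0 = z.
  apply: metric_proj_unique => // y Zy.
  (* Expanding [haugazeau_sub] at [y] around [z] and dropping the square of [x n - z] bounds the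
     constant by a quantity tending to 0. *)
  apply: (@ler_cvg_to _ U _ _ (fun=> _) _ _ _ (cvg_cst _) (xz0 ((y - z) + (x0 - z)))).
  apply: nearW => n; have := haugazeau_sub n y Zy; rewrite /halfspace /=.
  have -> : y - x n = (y - z) - (x n - z) by rewrite opprB addrA subrK.
  have -> : x0 - x n = (x0 - z) - (x n - z) by rewrite opprB addrA subrK.
  have := inner_ge0 (x n - z); move: (x n - z) (y - z) (x0 - z) => a b c.
  rewrite !innerE (innerC b a); lra.
apply/cvgrPdist_lt => e e0.
(* [haugazeau_sub] at [z] bounds the squared norm of [x n - z] by [inner (x n - z) (x0 - z)], so
   weak convergence becomes strong. *)
have /cvgrPdist_lt /(_ _ (exprn_gt0 2 e0)) := xz0 (x0 - z).
apply: filterS => n; rewrite sub0r normrN => lt_e.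
rewrite distrC -(@ltr_pXn2r _ 2) ?nnegrE ?(ltW e0) // -inner_norm.
apply: le_lt_trans lt_e; apply: le_trans (ler_norm _).
have := haugazeau_sub n z Zz; rewrite /halfspace /=.
have -> : x0 - x n = (x0 - z) - (x n - z) by rewrite opprB addrA subrK.
rewrite -[z - x n]opprB; move: (x n - z) (x0 - z) => a b.
rewrite !innerE; lra.
Qed.

End HaugazeauIteration.

(** * The splitting iteration for [W + C] *)

Theorem theorem4p9 (R : realType) (H : hilbertType R) (alpha : R)
    (halpha : 0 < alpha)
    (W : H -> set H) (hW : maximally_monotone W)
    (C : H -> H) (hC : cocoercive alpha C)
    (hZ : zer (addop W C) !=set0)
    (x0 : H) (lambda : nat -> R) (hlambda : forall n, 0 < lambda n <= 1)
    (x w ws q ts d r : nat -> H) (delta : nat -> R)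
    (hx0 : x 0%N = x0)
    (hw : forall n, gra W (w n, ws n))
    (hts : forall n, ts n = ws n + C (q n))
    (hdelta : forall n, delta n =
      inner (x n - w n) (ts n) - `|w n - q n| ^+ 2 / (4 * alpha))
    (hd : forall n, d n =
      if 0 < delta n then (delta n / `|ts n| ^+ 2) *: ts n else 0)
    (hr : forall n, r n = x n - lambda n *: d n)
    (hx : forall n, x n.+1 = Q x0 (x n) (r n)) :
  [/\ (forall n, halfspace x0 (x n) `&` halfspace (x n) (r n) !=set0),
      bounded_set (range x),
      (\sum_(0 <= n <oo) (`|x n.+1 - x n| ^+ 2)%:E < +oo)%E,
      (\sum_(0 <= n <oo) (lambda n ^+ 2 * `|d n| ^+ 2)%:E < +oo)%E
    & weak_cvg (fun n => w n - x n) 0 ->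
      w n - q n @[n --> \oo] --> 0 ->
      ts n @[n --> \oo] --> 0 ->
      x n @[n --> \oo] --> metric_proj (zer (addop W C)) x0].
Proof.
pose Z := zer (addop W C).
have Zr n : Z `<=` halfspace (x n) (r n).
  move=> z Zz; rewrite /halfspace /= hr hd.
  case: ifPn => [delta0|_]; last by rewrite scaler0 subr0 subrr inner0r.
  have zle := zer_addop_inner_le _ _ _ _ _ _ _ _ halpha hW.1 hC (hw n) (hts n) Zz.
  (* If [ts n] vanished, [delta n] would be nonpositive. *)
  have T0 : 0 < inner (ts n) (ts n).
    rewrite lt0r inner_ge0 andbT; apply/eqP => /inner_eq0 t0.
    move: delta0; rewrite hdelta t0 inner0r sub0r oppr_gt0 ltNge.
    by rewrite divr_ge0 ?sqr_ge0 // mulr_ge0 ?ltW.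
  have zx : inner (z - x n) (ts n) <= - delta n.
    move: zle; rewrite hdelta !innerE; move: (_ / (4 * alpha)) => b zle; lra.
  rewrite -inner_norm; set s := delta n / _.
  have s0 : 0 < s by rewrite divr_gt0.
  have sT : s * inner (ts n) (ts n) = delta n by rewrite /s divfK ?gt_eqF.
  have /andP[l0 l1] := hlambda n.
  rewrite subKr opprB addrA addrAC scalerA innerDl !innerZl !innerZr.
  move: (inner (z - x n) (ts n)) zx (inner (ts n) (ts n)) T0 sT => u ud T T0 sT.
  (* It remains to see that [u + lambda n * delta n <= 0], which follows from [u <= - delta n] and
     [lambda n <= 1]. *)
  have -> : lambda n * s * u + lambda n * s * (lambda n * s * T) =
    lambda n * s * (u + lambda n * delta n) by rewrite -sT; ring.
  rewrite pmulr_rle0; [nra|exact: mulr_gt0].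
have [M xM] := haugazeau_bounded Z x0 x r hZ hx0 hx Zr.
have [B sumB] := haugazeau_sum_le Z x0 x r hZ hx0 hx Zr.
split.
- by move=> n; exists (x n.+1); exact: (haugazeau_mem Z).
- exists M; split; first exact: num_real.
  by move=> a Ma _ [n _ <-]; apply: le_trans (xM n) (ltW Ma).
- exact: nneseries_bounded sumB.
- apply: (nneseries_bounded _ B).
    by move=> n; rewrite mulr_ge0 // sqr_ge0.
  move=> n; apply: le_trans (sumB n); apply: ler_sum => k _.
  apply: le_trans (haugazeau_step_ge Z x0 x r hZ hx0 hx Zr k).
  rewrite hr subKr normrZ exprMn real_normK ?num_real //.
move=> wx wq t0.
have [M1 wxM] := weak_cvg_bounded _ _ wx.
have [M2 wqM] : exists M, forall n, `|w n - q n| <= M.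
  have [A [_ /(_ (A + 1)) hA]] : bounded_fun (fun n => w n - q n).
    by apply: cvg_seq_bounded; apply/cvg_ex; exists 0.
  by exists (A + 1) => n; apply: hA => //; rewrite ltrDl.
have wM n : `|w n| <= M1 + M.
  by rewrite -[w n](subrK (x n)); apply: le_trans (ler_normD _ _) (lerD _ _).
have [M3 CM] : exists M, forall n, `|C (q n)| <= M.
  (* [C] is Lipschitz with constant [alpha^-1], and [q n = w n - (w n - q n)] has norm at most
     [M1 + M + M2]. *)
  exists (alpha^-1 * (M1 + M + M2) + `|C 0|) => n.
  rewrite -[C (q n)](subrK (C 0)); apply: le_trans (ler_normD _ _) (lerD _ _) => //.
  apply: le_trans (cocoercive_bound _ _ _ _ halpha hC) _.
  rewrite ler_pM2l ?invr_gt0 // subr0.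
  have -> : q n = w n - (w n - q n) by rewrite subKr.
  by apply: le_trans (ler_normB _ _) (lerD _ _).
apply: (haugazeau_cvg Z x0 x r hZ hx0 hx Zr) => U UU ooU.
have PU := @ultra_proper _ _ UU.
have [z xz] := ultrafilter_weak_cvg x M xM.
have [c Cc] := ultrafilter_weak_cvg (C \o q) M3 CM.
exists z => //.
have UooE (V : Type) (f : nat -> V) : f n @[n --> \oo] `<=` f n @[n --> U].
  by move=> A; exact: ooU.
apply: (@zer_addop_weak_limit R H U PU alpha W C w ws q ts z c
  (Num.max (M1 + M) M3)) => //.
- by move=> n; rewrite le_max wM.
- by move=> n; rewrite le_max CM orbT.
(* Since [w n - x n] tends weakly to 0, [w n] inherits the weak limit of [x n] along [U]. *)
- move=> y; rewrite -[inner z y]add0r -(inner0l y).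
  rewrite (_ : (fun n => _) = (fun n => inner (w n - x n) y + inner (x n) y)).
    by apply: cvgD; [exact: cvg_trans (UooE _ _) (wx y)|exact: xz].
  by apply/funext => n; rewrite -innerDl subrK.
- exact: cvg_trans (UooE _ _) wq.
- exact: cvg_trans (UooE _ _) t0.
Qed.
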